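(* Let $L$ be a frame, let $(P;e)$ be an $L$-ordered set, $(Q;e')$ an $L$-complete lattice, and $f:P\to Q$ a map. For each $x\in P$ define $S_x:Q\to L$ by $S_x(y)=\bigvee_{\{z\in P \mid f(z)=y\}}e(z,x)$, and define $F:P\to Q$ by $F(a)=\sqcup S_a$ for all $a\in P$. Then $F$ is monotone. Moreover, $f$ is monotone if and only if $f=F$.
   Context: A frame is a complete lattice $L$ (with bottom $0$, top $1$) satisfying $a\wedge\bigvee S=\bigvee_{s\in S}(a\wedge s)$ for all $a\in L$, $S\subseteq L$; its relative pseudocomplement is $a\to b=\bigvee\{x\in L\mid a\wedge x\le b\}$. $L^P$ is the set of all maps $P\to L$. An $L$-ordered set is a pair $(P;e)$ with $P$ a set and $e:P\times P\to L$ a map such that for all $x,y,z\in P$: (E1) $e(x,x)=1$; (E2) $e(x,y)\wedge e(y,z)\le e(x,z)$; (E3) $e(x,y)=e(y,x)=1$ implies $x=y$. For $S\in L^P$, an element $x_0\in P$ is the join of $S$, written $x_0=\sqcup S$, if for all $x\in P$: $S(x)\le e(x,x_0)$ and $\bigwedge_{y\in P}(S(y)\to e(y,x))\le e(x_0,x)$. It is the meet, $x_0=\sqcap S$, if for all $x\in P$: $S(x)\le e(x_0,x)$ and $\bigwedge_{y\in P}(S(y)\to e(x,y))\le e(x,x_0)$. Joins and meets are unique when they exist. $(P;e)$ is an $L$-complete lattice if $\sqcup S$ and $\sqcap S$ exist for every $S\in L^P$. A map $f:P\to Q$ between $L$-ordered sets $(P;e)$ and $(Q;e')$ is monotone if $e(x,y)\le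 e'(f(x),f(y))$ for all $x,y\in P$. *)

(* Defs.v *)
From HB Require Import structures.
From mathcomp Require Import all_boot all_order.
From mathcomp Require Import boolp classical_sets.

Set Implicit Arguments.
Unset Strict Implicit.
Unset Printing Implicit Defensive.

Import Order.TTheory.

Local Open Scope classical_set_scope.
Local Open Scope order_scope.

(* The defaults \bot and \top are the values [supremum] and [infimum] take on
   the empty set, which are the right ones in a complete lattice. *)
Definition csup d (L : tbLatticeType d) (A : set L) : L := supremum \bot A.
Definition cinf d (L : tbLatticeType d) (A : set L) : L := infimum \top A.

HB.mixin Record isFrame d L of Order.TBLattice d L := {
  has_supremum : forall A : set L, supremums A !=set0;
  has_infimum : forall A : set L, infimums A !=set0;
  meet_csup : forall (a : L) (A : set L),
    a `&` csup A = csup [set a `&` s | s in A]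
}.

#[short(type="frameType")]
HB.structure Definition Frame d := { L of isFrame d L & Order.TBLattice d L }.

Definition pseudocompl d (L : frameType d) (a b : L) : L :=
  csup [set x | a `&` x <= b].

Notation "a ~>> b" := (pseudocompl a b)
  (at level 55, right associativity) : order_scope.

HB.mixin Record isLOrdered d (L : frameType d) (P : Type) := {
  lle : P -> P -> L;
  lle_refl : forall x, lle x x = \top;
  lle_trans : forall x y z, lle x y `&` lle y z <= lle x z;
  lle_anti : forall x y, lle x y = \top -> lle y x = \top -> x = y
}.

#[short(type="lorderedType")]
HB.structure Definition LOrdered d (L : frameType d) :=
  { P of isLOrdered d L P }.

Definition is_ljoin d (L : frameType d) (P : lorderedType L)
    (S : P -> L) (x0 : P) : Prop :=
  forall x, S x <= lle x x0 /\
    cinf [set S y ~>> lle y x | y in [set: P]] <= lle x0 x.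

Definition is_lmeet d (L : frameType d) (P : lorderedType L)
    (S : P -> L) (x0 : P) : Prop :=
  forall x, S x <= lle x0 x /\
    cinf [set S y ~>> lle x y | y in [set: P]] <= lle x x0.

HB.mixin Record LOrdered_isLComplete d (L : frameType d) P
    of LOrdered d L P := {
  ex_ljoin : forall S : P -> L, exists x0 : P, is_ljoin S x0;
  ex_lmeet : forall S : P -> L, exists x0 : P, is_lmeet S x0
}.

#[short(type="lcompleteType")]
HB.structure Definition LComplete d (L : frameType d) :=
  { P of LOrdered_isLComplete d L P & LOrdered d L P }.

Definition ljoin d (L : frameType d) (Q : lcompleteType L) (S : Q -> L) : Q :=
  sval (cid (ex_ljoin S)).

Lemma ljoinP d (L : frameType d) (Q : lcompleteType L) (S : Q -> L) :
  is_ljoin S (ljoin S).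
Proof. exact: svalP (cid (ex_ljoin S)). Qed.

Definition lmonotone d (L : frameType d) (P Q : lorderedType L)
    (f : P -> Q) : Prop :=
  forall x y, lle x y <= lle (f x) (f y).

(* Main.v *)
Require Import Defs.
From mathcomp Require Import all_boot all_order.
From mathcomp Require Import boolp classical_sets.

Set Implicit Arguments.
Unset Strict Implicit.
Unset Printing Implicit Defensive.

Import Order.TTheory.

Local Open Scope classical_set_scope.
Local Open Scope order_scope.

(** To bound [lle (F a) x] below by [u], it is enough that [u]&[lle z a <= lle (f z) x] for every
    [z]: [ljoin_le] tests the join pointwise, and [meet_csup_le] splits each value [S a y] over the
    fibre of [f]. For [F] monotone this follows by transitivity in [P]; for [F a] below [f a] it is
    exactly monotonicity of [f]. *)

Section Frame.
Context d (L : frameType d).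
Implicit Types (a b x u : L) (A : set L).

Lemma csup_supremums A : supremums A (csup A).
Proof.
rewrite /csup /supremum; case: eqP => [->|_].
  by split=> [y //|y _]; exact: le0x.
by case: xgetP => [y _ //|none]; case: (has_supremum A) => y /none.
Qed.

Lemma cinf_infimums A : infimums A (cinf A).
Proof.
rewrite /cinf /infimum; case: eqP => [->|_].
  by split=> [y //|y _]; exact: lex1.
by case: xgetP => [y _ //|none]; case: (has_infimum A) => y /none.
Qed.

Lemma csup_ub A x : A x -> x <= csup A.
Proof. by have [ub _] := csup_supremums A; exact: ub. Qed.

Lemma csup_le_ub A u : (forall x, A x -> x <= u) -> csup A <= u.
Proof. by have [_ le_ub] := csup_supremums A; exact: le_ub. Qed.

Lemma lb_le_cinf A u : (forall x, A x -> u <= x) -> u <= cinf A.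
Proof. by have [_ lb_le] := cinf_infimums A; exact: lb_le. Qed.

(** The frame distributive law enters here. *)
Lemma meet_csup_le a A u :
  (forall x, A x -> a `&` x <= u) -> a `&` csup A <= u.
Proof.
move=> le_u; rewrite meet_csup; apply: csup_le_ub => _ [x Ax <-].
exact: le_u.
Qed.

Lemma le_pseudocompl a b u : a `&` u <= b -> u <= a ~>> b.
Proof. by move=> le_b; exact: csup_ub. Qed.

End Frame.

Section LComplete.
Context d (L : frameType d) (Q : lcompleteType L).
Implicit Types (S : Q -> L) (u : L).

Lemma le_ljoin S y : S y <= lle y (ljoin S).
Proof. by have [] := ljoinP S y. Qed.

(** By residuation [u] lies below each [S y ~>> lle y x], hence below their infimum, which bounds
    [lle (ljoin S) x] from below. *)
Lemma ljoin_le S x u :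
  (forall y, u `&` S y <= lle y x) -> u <= lle (ljoin S) x.
Proof.
move=> le_x; have [_] := ljoinP S x; apply: le_trans.
apply: lb_le_cinf => _ [y _ <-]; apply: le_pseudocompl.
by rewrite meetC.
Qed.

End LComplete.

Theorem theorem3p3 (d : Order.disp_t) (L : frameType d)
    (P : lorderedType L) (Q : lcompleteType L) (f : P -> Q) :
  let S (x : P) (y : Q) : L := csup [set lle z x | z in [set z | f z = y]] in
  let F (a : P) : Q := ljoin (S a) in
  lmonotone F /\ (lmonotone f <-> f = F).
Proof.
move=> S F.
have lle_S z a : lle z a <= S a (f z) by apply: csup_ub; exists z.
have F_mono : lmonotone F.
  move=> a b; apply: ljoin_le => y; apply: meet_csup_le => _ [z <- <-].
  (* Transitivity through [a] yields [lle z b], one of the terms of [S b (f z)]. *)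
  rewrite meetC; apply: le_trans (lle_trans z a b) _.
  exact: le_trans (lle_S z b) (le_ljoin _ _).
split=> //; split=> [f_mono|->//].
apply/funext => a; apply: lle_anti; apply/eqP; rewrite -le1x.
  (* [a] lies in its own fibre, so [S a (f a)] is already [\top]. *)
  by rewrite -(lle_refl a); exact: le_trans (lle_S a a) (le_ljoin _ _).
apply: ljoin_le => y; apply: meet_csup_le => _ [z <- <-].
by rewrite meet1x; exact: f_mono.
Qed.
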